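(* There exist constants $C>0$ and $N\in\mathbb{N}$ such that for every integer $n\ge N$ the following hold. (i) If $n$ is even, then $F_n$ contains every even integer $m$ with $n^{3/2}+Cn^{5/4}\le m\le \binom{n}{3}-\left(n^{3/2}+Cn^{5/4}\right)$. This is best possible up to the second order term: there is an even integer $m\notin F_n$ with $0\le m\le\frac12\binom n3$ and $\left|m-n^{3/2}\right|\le Cn^{5/4}$. (ii) If $n$ is odd, then $F_n$ contains every integer $m$ with $\sqrt2\,n^{3/2}+Cn^{5/4}\le m\le \binom{n}{3}-\left(\sqrt2\,n^{3/2}+Cn^{5/4}\right)$. This is best possible up to the second order term: there is an integer $m\notin F_n$ with $0\le m\le\frac12\binom n3$ and $\left|m-\sqrt2\,n^{3/2}\right|\le Cn^{5/4}$.
   Context: All graphs are finite and simple. A triple of distinct vertices of a graph is a frustrated triangle if it induces an odd number of edges, and $f(G)$ denotes the number of frustrated triangles (unordered triples) in $G$. $F_n=\{f(G): G\text{ is a graph on } n \text{ vertices}\}$. *)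

(* Defs.v *)
From mathcomp Require Import all_boot.

Set Implicit Arguments.
Unset Strict Implicit.
Unset Printing Implicit Defensive.

Record simple_graph (T : finType) := SimpleGraph {
  adj :> rel T;
  adj_sym : symmetric adj;
  adj_irr : irreflexive adj
}.

(* An edge is the unordered pair of its endpoints. *)
Definition edges (T : finType) (G : simple_graph T) : {set {set T}} :=
  [set E | [exists x, exists y, G x y && (E == [set x; y])]].

Definition induced_edges (T : finType) (G : simple_graph T) (A : {set T})
  : {set {set T}} := [set E in edges G | E \subset A].

Definition frustrated (T : finType) (G : simple_graph T) (A : {set T}) : bool :=
  (#|A| == 3) && odd #|induced_edges G A|.

Definition num_frustrated (T : finType) (G : simple_graph T) : nat :=
  #|[set A : {set T} | frustrated G A]|.

(* [F n m] reads "m belongs to F_n"; up to isomorphism the vertex set of a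
   graph on n vertices is 'I_n. *)
Definition F (n m : nat) : Prop :=
  exists G : simple_graph 'I_n, num_frustrated G = m.

(* Main.v *)
Require Import Defs.
From mathcomp Require Import all_boot all_order all_algebra zify ring lra.
From mathcomp Require Import reals exp.
Set Implicit Arguments.
Unset Strict Implicit.
Unset Printing Implicit Defensive.

(** Write f(G) for the number of frustrated triangles of a graph G with n
    vertices and e edges.

    Adding an edge uv to G reverses the status of exactly the n - 2 triples
    containing u and v, and the frustrated ones among them are given by the
    vertices w joined to exactly one of u and v; if there are k of those, then
    f grows by n - 2 - 2k ([num_frustrated_add]).  As k <= e, induction on the
    edges gives
      e(n - 1 - e) <= f(G) <= e(n - 2)   and   f(G) = n e modulo 2.
    Moreover f is invariant under switching ([num_frustrated_switch]), and
    switching G with respect to the neighbourhood of a vertex v produces a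
    graph whose edges correspond to the frustrated triples of G through v; by
    averaging over v, some switching of G has at most 3 f(G) / n edges
    ([sparse_switch]).

    Missing values.  Let d = 1 for n even and d = 2 for n odd, and let
    m = t(n - 2) + 2 with t + d about sqrt(d n).  Suppose that f(G) = m, with
    G sparse as above, so that e <= 3t.  Then e <= t is impossible since
    m > t(n - 2), and t + d <= e <= 3t is impossible since
    m < (t + d)(n - 1 - t - d); for d = 2 the remaining case e = t + 1 is
    excluded by parity.  This is [gap_notin_F].

    Attained values.  Taking complements replaces m by C(n, 3) - m, so let
    m <= C(n, 3) / 2.  A disjoint star with j edges adds j(n - 2) - j(j - 1) to
    f, so a forest of stars with t edges adds t(n - 2) - S, where S is the sum
    of the j(j - 1).  A greedy choice shows that every even S < d n arises from
    a forest with at most t = sqrt(d n) + O(n^(1/4)) edges ([three_pronics]),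
    and then every r >= t(n - 2) with the right parity is the contribution of
    some forest, as long as there are enough vertices.  As only O(sqrt n) edges are needed to reach r in
    [t(n - 2), t(n - 2) + n], it remains to find a graph supported on about
    2n/3 vertices with f in a prescribed window of length n.  Deleting the
    edges of a clique one by one changes f by at most n - 2 at each step
    ([num_frustrated_near]), and a clique K_A with |A| >= 2n/3 has
    f(K_A) >= C(n, 3) / 2, because its complement switches to the clique on
    the complement of A, which has few edges.  This is [mem_F].

    The last part rewrites these bounds in terms of r = n^(1/4). *)

(** * Parity of a triple, switching and complements *)

Section Parity.
Variable T : finType.
Implicit Types (G H : simple_graph T) (A E : {set T}) (u v w x y z : T).

Lemma in_edges G x y : ([set x; y] \in edges G) = G x y.
Proof.
rewrite inE; apply/existsP/idP => [[a /existsP[b /andP[Gab /eqP/setP eq_ab]]]|Gxy]; last first.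
  by exists x; apply/existsP; exists y; rewrite Gxy eqxx.
have a'b: a != b by apply: contraTN Gab => /eqP->; rewrite adj_irr.
have := eq_ab a; have := eq_ab b; have := eq_ab x; have := eq_ab y.
rewrite !inE !eqxx ?orbT /= => /esym/orP[]/eqP-> /esym/orP[]/eqP->; rewrite ?(adj_sym G b) //.
- by rewrite !orbb eq_sym (negPf a'b).
- by rewrite !orbb (negPf a'b).
Qed.

Lemma edgesP G E :
  reflect (exists x y, [/\ x != y, G x y & E = [set x; y]]) (E \in edges G).
Proof.
apply: (iffP idP) => [|[x [y [_ Gxy ->]]]]; last by rewrite in_edges.
rewrite inE => /existsP[x /existsP[y /andP[Gxy /eqP->]]]; exists x, y.
by split=> //; apply: contraTN Gxy => /eqP->; rewrite adj_irr.
Qed.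

Lemma card3_set3 A : #|A| = 3 ->
  exists x y z, [/\ x != y, y != z, x != z & A = [set x; y; z]].
Proof.
move=> A3; have : 0 < #|A| by rewrite A3.
case/card_gt0P=> x Ax.
have /eqP/cards2P[y [z [y'z Ayz]]] : #|A :\ x| = 2.
  by apply/eqP; rewrite -eqSS -A3 (cardsD1 x A) Ax.
have : y \in A :\ x by rewrite Ayz !inE eqxx.
have : z \in A :\ x by rewrite Ayz !inE eqxx orbT.
rewrite !inE => /andP[z'x _] /andP[y'x _].
exists x, y, z; split=> //; rewrite 1?eq_sym //.
by rewrite -(setD1K Ax) Ayz setUA.
Qed.

(** A triple is frustrated when the sum modulo 2 of its three adjacencies is 1. *)
Lemma frustrated3 G x y z : x != y -> y != z -> x != z ->
  frustrated G [set x; y; z] = G x y (+) G y z (+) G x z.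
Proof.
move=> xy yz xz; rewrite /frustrated.
have -> : #|[set x; y; z]| == 3.
  by rewrite -setUA cardsU1 cards2 !inE negb_or xy xz yz.
pose s := [:: [set x; y]; [set y; z]; [set x; z]].
have neq a (A B : {set T}) : a \in A -> a \notin B -> A != B.
  by move=> Aa; apply: contraNneq => <-.
have s_uniq : uniq s.
  rewrite cons_uniq [_ \in _]inE [_ \in _]inE negb_or /= inE andbT.
  rewrite (neq x [set x; y]) ?(neq y [set x; y]) ?(neq y [set y; z]) //;
    by rewrite !inE ?eqxx ?orbT // negb_or ?xy ?yz ?xz // eq_sym xy.
have -> : #|induced_edges G [set x; y; z]| = count (mem (edges G)) s.
  rewrite -size_filter -(card_uniqP (filter_uniq _ s_uniq)); apply: eq_card => E.
  rewrite mem_filter /induced_edges [LHS]inE; apply: andb_id2l => /edgesP[a [b [ab _ ->]]].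
  apply/idP/idP => [/subsetP sE|].
    have := sE a; have := sE b; rewrite !inE !eqxx ?orbT => /(_ isT) eb /(_ isT) ea.
    move: eb ea ab; rewrite -!orbA => /or3P[]/eqP-> /or3P[]/eqP->;
      by rewrite ?eqxx ?orbT // => _; rewrite [[set _; _]]setUC eqxx ?orbT.
  rewrite !inE => /or3P[]/eqP->; apply/subsetP => w; rewrite !inE => /orP[]->; rewrite ?orbT //.
rewrite /= addn0 !in_edges.
by case: (G x y); case: (G y z); case: (G x z).
Qed.

(** Switching with respect to [c] flips the pairs separated by [c]; any triple
    contains an even number of them. *)
Lemma num_frustrated_switch G G' (c : pred T) :
  (forall x y, x != y -> G' x y = G x y (+) c x (+) c y) ->
  num_frustrated G' = num_frustrated G.
Proof.
move=> sw; apply: eq_card => A; rewrite !inE.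
case: (eqVneq #|A| 3) => [/card3_set3[x [y [z [xy yz xz ->]]]]|/negPf A3]; last first.
  by rewrite /frustrated A3.
rewrite !frustrated3 // !sw //.
by case: (G x y) (G y z) (G x z) (c x) (c y) (c z) => [] [] [] [] [] [].
Qed.

(** The complement graph. *)
Definition compl_rel G : rel T := [rel x y | (x != y) && ~~ G x y].
Lemma compl_sym G : symmetric (compl_rel G).
Proof. by move=> x y; rewrite /compl_rel /= eq_sym adj_sym. Qed.
Lemma compl_irr G : irreflexive (compl_rel G).
Proof. by move=> x; rewrite /compl_rel /= eqxx. Qed.
Definition compl G := SimpleGraph (compl_sym G) (compl_irr G).

Lemma num_frustrated_compl G :
  num_frustrated G + num_frustrated (compl G) = 'C(#|T|, 3).
Proof.
rewrite -cardsT -cards_draws /num_frustrated.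
rewrite -[RHS](cardsID [set A | frustrated G A]).
congr (_ + _); apply: eq_card => A; rewrite !inE subsetT /=.
all: case: (eqVneq #|A| 3) => [/card3_set3[x [y [z [xy yz xz ->]]]]|/negPf A3].
all: rewrite ?andbF ?andbT //=; try by rewrite /frustrated A3.
rewrite !frustrated3 //= /compl_rel /= xy yz xz /=.
by case: (G x y) (G y z) (G x z) => [] [] [].
Qed.

(** The unordered pairs [{u, v}] and [{x, y}] coincide (for [u != v]). *)
Definition same_pair u v x y := (x == u) && (y == v) || (x == v) && (y == u).

(** [G'] is [G] with the new edge [uv]. *)
Definition adds_edge G G' u v := [/\ u != v, ~~ G u v, G' u v &
  forall x y, ~~ same_pair u v x y -> G' x y = G x y].

(** The other vertices that are joined to exactly one of [u] and [v]. *)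
Definition split_nbrs G u v := [set w | [&& w != u, w != v & G u w (+) G v w]].

Lemma card_frustrated_pair G u v : u != v ->
  #|[set A | frustrated G A & [set u; v] \subset A]| =
  #|[set w | [&& w != u, w != v & G u v (+) G u w (+) G v w]]|.
Proof.
move=> uv; rewrite -(card_in_imset (f := fun w => [set u; v; w])); last first.
  move=> w w'; rewrite !inE => /and3P[wu wv _] /and3P[w'u w'v _] /setP/(_ w).
  by rewrite !inE eqxx orbT (negPf wu) (negPf wv) => /esym/eqP.
apply: eq_card => A; rewrite !inE; apply/idP/imsetP => [/andP[fA]|[w]].
  rewrite subUset !sub1set => /andP[Au Av].
  have /eqP A3 : #|A| == 3 by case/andP: fA.
  have Av' : v \in A :\ u by rewrite !inE eq_sym uv.
  have /eqP/cards1P[w Aw] : #|A :\ u :\ v| = 1.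
    by apply/eqP; rewrite -2!eqSS -A3 (cardsD1 u A) Au (cardsD1 v (A :\ u)) Av'.
  have : w \in A :\ u :\ v by rewrite Aw inE.
  rewrite !inE => /and3P[wv wu _].
  have defA : A = [set u; v; w].
    by rewrite -(setD1K Au) -(setD1K Av') Aw setUA.
  exists w => //; rewrite !inE wu wv /=; move: fA; rewrite defA frustrated3 // 1?(eq_sym _ w) //.
  by rewrite -!addbA [G v w (+) _]addbC.
rewrite !inE => /and3P[wu wv odd_w] ->; rewrite subsetUl andbT frustrated3 // 1?(eq_sym _ w) //.
by rewrite -addbA [G v w (+) _]addbC addbA.
Qed.

Lemma num_frustrated_add G G' u v : adds_edge G G' u v ->
  num_frustrated G' + 2 * #|split_nbrs G u v| = num_frustrated G + (#|T| - 2).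
Proof.
case=> uv Guv G'uv eqG; rewrite /num_frustrated.
rewrite -(cardsID [set A : {set T} | [set u; v] \subset A] [set A : {set T} | frustrated G' A]).
rewrite -(cardsID [set A : {set T} | [set u; v] \subset A] [set A : {set T} | frustrated G A]).
have eq_out : [set A : {set T} | frustrated G' A] :\: [set A : {set T} | [set u; v] \subset A]
    = [set A : {set T} | frustrated G A] :\: [set A : {set T} | [set u; v] \subset A].
  apply/setP => A; rewrite !inE; apply: andb_id2l => uvA.
  case: (eqVneq #|A| 3) => [/card3_set3[x [y [z [xy yz xz defA]]]]|/negPf A3]; last first.
    by rewrite /frustrated A3.
  rewrite defA !frustrated3 // !eqG //; apply: contra uvA => /orP[]/andP[/eqP<- /eqP<-];
    by rewrite defA subUset !sub1set !inE !eqxx ?orbT.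
have pairE H : [set A : {set T} | frustrated H A]
    :&: [set A : {set T} | [set u; v] \subset A]
    = [set A | frustrated H A & [set u; v] \subset A].
  by apply/setP => A; rewrite !inE.
rewrite eq_out !pairE.
rewrite !card_frustrated_pair // (negPf Guv) G'uv.
have eq_nbr w : w != u -> w != v -> (G' u w = G u w) * (G' v w = G v w).
  by move=> wu wv; split; apply: eqG; rewrite /same_pair (negPf wu) (negPf wv) !andbF.
have -> : [set w | [&& w != u, w != v & true (+) G' u w (+) G' v w]]
   = ~: [set u; v] :\: split_nbrs G u v.
  apply/setP => w; rewrite !inE negb_or.
  case: (eqVneq w u) => [_|wu]; rewrite ?andbF //=.
  case: (eqVneq w v) => [_|wv]; rewrite ?andbF //=.
  by rewrite !eq_nbr // andbT; case: (G u w); case: (G v w).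
have := cardsID (split_nbrs G u v) (~: [set u; v]).
rewrite (setIidPr _); last by apply/subsetP => w; rewrite !inE negb_or => /and3P[-> ->].
have := cardsC [set u; v]; rewrite cards2 uv /= -[[set w | _]]/(split_nbrs G u v).
by lia.
Qed.

End Parity.

(** * Edge-by-edge estimates *)

Section EdgeByEdge.
Variable T : finType.
Implicit Types (G H : simple_graph T) (A E : {set T}) (u v w x y z : T).

Lemma same_pairC u v x y : same_pair u v x y = same_pair u v y x.
Proof. by rewrite /same_pair orbC andbC [X in _ || X]andbC. Qed.

(** The graph [G] without the edge [uv]. *)
Definition del_rel G u v : rel T := [rel x y | G x y && ~~ same_pair u v x y].
Lemma del_sym G u v : symmetric (del_rel G u v).
Proof. by move=> x y; rewrite /del_rel /= adj_sym same_pairC. Qed.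
Lemma del_irr G u v : irreflexive (del_rel G u v).
Proof. by move=> x; rewrite /del_rel /= adj_irr. Qed.
Definition del_edge G u v := SimpleGraph (del_sym G u v) (del_irr G u v).

Lemma adds_edge_card G G' u v :
  adds_edge G G' u v -> #|edges G'| = #|edges G|.+1.
Proof.
case=> uv Guv G'uv eqG.
have -> : edges G' = [set u; v] |: edges G.
  apply/setP => E; rewrite in_setU1; apply/edgesP/predU1P.
    case=> x [y [_ G'xy ->]]; case: (boolP (same_pair u v x y)) => [|xy].
      by case/orP => /andP[/eqP-> /eqP->]; left; rewrite // setUC.
    by right; rewrite in_edges -eqG.
  case=> [->|/edgesP[x [y [xy Gxy ->]]]]; [by exists u, v | exists x, y].
  split=> //; rewrite eqG //; apply: contraL Gxy.
  by case/orP => /andP[/eqP-> /eqP->] //; rewrite adj_sym.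
by rewrite cardsU1 in_edges Guv.
Qed.

(** Induction on the number of edges, along a chain of subgraphs. *)
Lemma edges_ind (P : simple_graph T -> Prop) :
  (forall G, edges G = set0 -> P G) ->
  (forall G G' u v, adds_edge G G' u v -> subrel G G' -> P G -> P G') ->
  forall G, P G.
Proof.
move=> P0 PS G; have [n] := ubnP #|edges G|; elim: n G => // n IHn G leGn.
case: (set_0Vmem (edges G)) => [/P0 //|[E /edgesP[u [v [uv Guv _]]]]].
have addG : adds_edge (del_edge G u v) G u v.
  split=> //; first by rewrite /= /del_rel /= /same_pair !eqxx andbF.
  by move=> x y /= xy; rewrite /del_rel /= xy andbT.
apply: (PS _ _ _ _ addG) => [x y /andP[]|] //.
by apply: IHn; rewrite (adds_edge_card addG) in leGn.
Qed.

(** Each vertex of [split_nbrs G u v] has its own edge to [u] or [v]. *)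
Lemma card_split_nbrs G u v : #|split_nbrs G u v| <= #|edges G|.
Proof.
pose h w := if G u w then [set u; w] else [set v; w].
have inj_h : {in split_nbrs G u v &, injective h}.
  move=> w w'; rewrite !inE => /and3P[wu wv _] /and3P[w'u w'v _].
  move=> /setP/(_ w); rewrite /h.
  by case: ifP; case: ifP; rewrite !inE eqxx orbT ?(negPf wu) ?(negPf wv) => _ _ /esym/eqP.
rewrite -(card_in_imset inj_h); apply/subset_leq_card/subsetP => E /imsetP[w].
by rewrite inE /h => /and3P[_ _]; case: ifP => Guw /= Gw ->; rewrite in_edges // Guw.
Qed.

Lemma num_frustrated0 G : edges G = set0 -> num_frustrated G = 0.
Proof.
move=> G0; apply/eqP; rewrite cards_eq0; apply/eqP/setP => A; rewrite !inE.
rewrite /frustrated; suff -> : induced_edges G A = set0 by rewrite cards0 andbF.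
by apply/setP => E; rewrite /induced_edges G0 !inE.
Qed.

Lemma num_frustrated_le G : num_frustrated G <= #|edges G| * (#|T| - 2).
Proof.
elim/edges_ind: G => [G G0|G G' u v addG _ IH]; first by rewrite num_frustrated0.
by have := num_frustrated_add addG; rewrite (adds_edge_card addG); lia.
Qed.

Lemma num_frustrated_ge G :
  #|edges G| * (#|T| - 2) <= num_frustrated G + #|edges G| * #|edges G|.-1.
Proof.
elim/edges_ind: G => [G G0|G G' u v addG _ IH]; first by rewrite G0 cards0.
have := num_frustrated_add addG; have := card_split_nbrs G u v.
rewrite (adds_edge_card addG); move: IH; set e := #|edges G|; case: e => [|e] /=; nia.
Qed.

Lemma odd_num_frustrated G : odd (num_frustrated G) = odd #|edges G| && odd #|T|.
Proof.
elim/edges_ind: G => [G G0|G G' u v addG _ IH].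
  by rewrite G0 cards0 num_frustrated0.
have T2 : 2 <= #|T|.
  have [uv _ _ _] := addG.
  by have := max_card (mem [set u; v]); rewrite cards2 uv.
have := congr1 odd (num_frustrated_add addG).
rewrite (adds_edge_card addG) mul2n !oddD odd_double addbF IH oddB //= addbF => ->.
by case: (odd _) (odd _) => [] [].
Qed.

(** Discrete continuity: every [b] below [num_frustrated G] is approached within
    [#|T|] from below by the value of a subgraph of [G]. *)
Lemma num_frustrated_near G b : b <= num_frustrated G ->
  exists H, [/\ subrel H G, num_frustrated H <= b & b <= num_frustrated H + #|T|].
Proof.
elim/edges_ind: G => [G G0|G G' u v addG sGG' IH].
  by rewrite num_frustrated0 // leqn0 => /eqP->; exists G; split; rewrite ?num_frustrated0.
move=> ltb; case: (leqP b (num_frustrated G)) => [/IH[H [sHG le1 le2]]|ltGb].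
  by exists H; split=> // x y /sHG/sGG'.
exists G; split=> //; first exact: ltnW.
by have := num_frustrated_add addG; lia.
Qed.

(** The switching of [G] with respect to the neighbourhood of [v], in which [v]
    becomes isolated. *)
Definition isolate_rel G v : rel T :=
  [rel x y | (x != y) && (G x y (+) G v x (+) G v y)].
Lemma isolate_sym G v : symmetric (isolate_rel G v).
Proof. by move=> x y; rewrite /isolate_rel /= eq_sym adj_sym addbAC. Qed.
Lemma isolate_irr G v : irreflexive (isolate_rel G v).
Proof. by move=> x; rewrite /isolate_rel /= eqxx. Qed.
Definition isolate G v := SimpleGraph (isolate_sym G v) (isolate_irr G v).

Lemma num_frustrated_isolate G v : num_frustrated (isolate G v) = num_frustrated G.
Proof.
by apply: (num_frustrated_switch (c := G v)) => x y xy; rewrite /= /isolate_rel /= xy.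
Qed.

Lemma isolate_adjE G v x y : isolate G v x y ->
  [/\ x != y, v != x, v != y & frustrated G [set v; x; y]].
Proof.
rewrite /= /isolate_rel /= => /andP[xy].
have [<-|vx] := eqVneq v x; first by rewrite adj_irr addbF addbb.
have [<-|vy] := eqVneq v y; first by rewrite adj_irr addbF adj_sym addbb.
by split=> //; rewrite frustrated3 // [G v x (+) _]addbC.
Qed.

(** The edge [xy] of [isolate G v] corresponds to the triple [{v, x, y}]. *)
Lemma card_edges_isolate G v :
  #|edges (isolate G v)| = #|[set A | frustrated G A & v \in A]|.
Proof.
rewrite -[LHS](card_in_imset (f := fun E => v |: E)); last first.
  move=> E E' /edgesP[x [y [_ /isolate_adjE[_ vx vy _] ->]]].
  move=> /edgesP[x' [y' [_ /isolate_adjE[_ vx' vy' _] ->]]] eqE.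
  have nin a b : v != a -> v != b -> v \notin [set a; b].
    by move=> va vb; rewrite !inE negb_or va.
  by rewrite -(setU1K (nin _ _ vx vy)) eqE setU1K ?nin.
apply: eq_card => A; rewrite inE; apply/imsetP/andP.
  case=> E /edgesP[x [y [_ /isolate_adjE[xy vx vy fA] ->]]] ->.
  by rewrite setU11 setUA.
case=> fA Av; have /eqP A3 : #|A| == 3 by case/andP: fA.
have /eqP/cards2P[x [y [xy Axy]]] : #|A :\ v| = 2.
  by apply/eqP; rewrite -eqSS -A3 (cardsD1 v A) Av.
have : y \in A :\ v by rewrite Axy !inE eqxx orbT.
have : x \in A :\ v by rewrite Axy !inE eqxx.
rewrite !inE ![_ == v]eq_sym => /andP[vx _] /andP[vy _].
have defA : A = [set v; x; y] by rewrite -(setD1K Av) Axy setUA.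
exists [set x; y]; last by rewrite defA setUA.
rewrite in_edges /= /isolate_rel /= xy /=.
by move: fA; rewrite defA frustrated3 // [G v x (+) _]addbC.
Qed.

Lemma sum_frustrated_at G :
  \sum_(v : T) #|[set A | frustrated G A & v \in A]| = 3 * num_frustrated G.
Proof.
rewrite /num_frustrated mulnC -sum_nat_const.
under eq_bigr do rewrite -sum1_card.
rewrite (exchange_big_dep (mem [set A | frustrated G A])) /=; last first.
  by move=> v A _; rewrite !inE => /andP[].
apply: eq_bigr => A; rewrite inE => fA.
have /eqP <- : #|A| == 3 by case/andP: fA.
by rewrite -sum1_card; apply: eq_bigl => v; rewrite inE fA.
Qed.

(** Averaging over [v], some graph [isolate G v] has at most
    [3 * num_frustrated G / #|T|] edges. *)
Lemma sparse_switch G : 0 < #|T| ->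
  exists2 H : simple_graph T, num_frustrated H = num_frustrated G &
             #|T| * #|edges H| <= 3 * num_frustrated G.
Proof.
move=> T0; suff /existsP[v le_v] :
    [exists v, #|T| * #|edges (isolate G v)| <= 3 * num_frustrated G].
  by exists (isolate G v) => //; apply: num_frustrated_isolate.
apply: contraT => /existsPn lt_v.
have : \sum_(v : T) 3 * num_frustrated G < \sum_(v : T) #|T| * #|edges (isolate G v)|.
  have [v0 _] := card_gt0P T0.
  rewrite [X in X < _](bigD1 v0) // [X in _ < X](bigD1 v0) //=.
  rewrite -addSn leq_add //; first by rewrite ltnNge.
  by apply: leq_sum => v _; apply: ltnW; rewrite ltnNge.
rewrite sum_nat_const -big_distrr /=.
by under eq_bigr do rewrite card_edges_isolate; rewrite sum_frustrated_at ltnn.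
Qed.

End EdgeByEdge.

(** * Values that are not attained *)

(** At most [t] edges give at most [t * (n - 2)] frustrated triangles, while a
    number of edges between [t + d] and [3 * t] gives more than
    [t * (n - 2) + 2]; for [d = 2] the graphs with [t + 1] edges have the wrong
    parity. *)
Lemma gap_notin_F n d t :
  (d == 1) || (d == 2) && odd n ->
  d + 2 < t -> 4 * t + d < n -> (t + d) ^ 2 <= d * n -> ~ F n (t * (n - 2) + 2).
Proof.
move=> dP lt_dt lt_tn le_dn [G0 fG0].
have [p def_n] : exists p, n = p.+2 by exists n.-2; lia.
subst n.
have [|G fG le_e] := sparse_switch G0; first by rewrite card_ord; lia.
have := odd_num_frustrated G; have := num_frustrated_ge G; have := num_frustrated_le G.
move: le_e; rewrite fG fG0 card_ord; set e := #|edges G|.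
rewrite !subn2 /= => le_e ub lb par.
have lt_te : t < e.
  rewrite ltnNge; apply/negP => le_et.
  by have : e * p <= t * p by [rewrite leq_mul2r le_et orbT]; lia.
have le_e3 : e <= 3 * t.
  rewrite leqNgt; apply/negP => lt_e.
  by have : p.+2 * (3 * t).+1 <= p.+2 * e by [rewrite leq_mul2l lt_e orbT]; lia.
have [le_tde|lt_etd] := leqP (t + d) e; last first.
  have [d2 e1 on] : [/\ d = 2, e = t.+1 & odd p].
    by case/orP: dP => [/eqP|/andP[/eqP]]; split; lia.
  by move: par; rewrite e1 oddD oddM /= on; case: (odd t).
(* The polynomial e (p + 1 - e) exceeds its value at t + d by a * b. *)
have [a def_a] : exists a, e = t + d + a by exists (e - (t + d)); lia.
have [b def_b] : exists b, p.+1 = e + (t + d) + b by exists (p.+1 - (e + (t + d))); lia.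
have {}lb : e * p + e <= t * p + 2 + e * e by case: (e) lb => //= e'; lia.
have {}le_dn : (t + d) * (t + d) <= d * p.+2 by rewrite mulnn.
have : e * p + e = (t + d) * p.+1 + a * b + e * e - (t + d) * (t + d).
  have -> : e * p + e = e * p.+1 by lia.
  by rewrite def_b def_a; lia.
by lia.
Qed.

(** * Cliques *)

Section Cliques.
Variable T : finType.
Implicit Types A : {set T}.

(** The graph whose edges are the pairs of elements of [A]. *)
Definition clique_rel A : rel T := [rel x y | [&& x != y, x \in A & y \in A]].
Lemma clique_sym A : symmetric (clique_rel A).
Proof. by move=> x y; rewrite /clique_rel /= eq_sym [(x \in A) && _]andbC. Qed.
Lemma clique_irr A : irreflexive (clique_rel A).
Proof. by move=> x; rewrite /clique_rel /= eqxx. Qed.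
Definition clique A := SimpleGraph (clique_sym A) (clique_irr A).

(** The complement of [clique A] switches to [clique (~: A)], whose edges each
    lie in at most [#|T| - 2] frustrated triples. *)
Lemma num_frustrated_clique A :
  'C(#|T|, 3) <= num_frustrated (clique A) + 'C(#|~: A|, 2) * (#|T| - 2).
Proof.
rewrite -(num_frustrated_compl (clique A)) leq_add2l.
rewrite -(@num_frustrated_switch _ _ (clique (~: A)) (mem A)); last first.
  move=> x y xy; rewrite /= /clique_rel /compl_rel /= /clique_rel /= xy !inE.
  by case: (x \in A) (y \in A) => [] [].
apply: leq_trans (num_frustrated_le _) _; rewrite leq_mul2r; apply/orP; right.
rewrite -cards_draws; apply/subset_leq_card/subsetP => E /edgesP[x [y [xy Exy ->]]].
move: Exy; rewrite /= /clique_rel /= => /and3P[_ xA yA].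
by rewrite inE subUset !sub1set xA yA cards2 xy.
Qed.

End Cliques.

Lemma bin3_ffact n : 6 * 'C(n, 3) = n * n.-1 * n.-2.
Proof. by rewrite mulnC -[6]/(3`!) bin_ffact ffactnS ffactnS ffactn1 mulnA. Qed.

(** A clique on at least two thirds of the vertices frustrates at least half of
    the triples. *)
Lemma clique_half_bin3 n (A : {set 'I_n}) :
  3 * #|~: A| <= n -> 'C(n, 3) <= 2 * num_frustrated (clique A).
Proof.
have := num_frustrated_clique A; rewrite card_ord; set b := #|~: A| => le_f le_b.
have := bin_ffact b 2; have := bin3_ffact n; rewrite ffactnS ffactn1 -[2`!]/2.
have : 6 * (b * b.-1) <= n * n.-1 by case: (b) le_b => [|b'] /=; case: (n) => [|n'] /=; nia.
move: le_f; rewrite subn2; move: 'C(n, 3) 'C(b, 2) n.-2 (n * n.-1) => C B p q le_f.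
move=> + eqC eqB; rewrite -eqB => /(leq_mul (leqnn p)) le_B.
by lia.
Qed.

(** * Forests of stars *)

Section AddEdge.
Variable T : finType.
Implicit Types (G : simple_graph T) (u v x y : T).

(** The graph [G] with the edge [uv] added. *)
Definition add_rel G u v : rel T :=
  [rel x y | (x != y) && (G x y || same_pair u v x y)].
Lemma add_sym G u v : symmetric (add_rel G u v).
Proof. by move=> x y; rewrite /add_rel /= eq_sym adj_sym same_pairC. Qed.
Lemma add_irr G u v : irreflexive (add_rel G u v).
Proof. by move=> x; rewrite /add_rel /= eqxx. Qed.
Definition add_edge G u v := SimpleGraph (add_sym G u v) (add_irr G u v).

Lemma add_edgeP G u v : u != v -> ~~ G u v -> adds_edge G (add_edge G u v) u v.
Proof.
move=> uv Guv; split=> //=; first by rewrite /add_rel /= uv /same_pair !eqxx orbT.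
move=> x y /negPf xy; rewrite /add_rel /= xy orbF.
by case: eqVneq => [->|//]; rewrite adj_irr.
Qed.

End AddEdge.

Section Forests.
Variable n : nat.
Implicit Types G H : simple_graph 'I_n.

(** All edges of [G] lie among the vertices [0, .., s - 1]. *)
Definition supported G s := forall x y, G x y -> x < s.

(** A star with [j] edges is added on the vertices [s, .., s + j], with centre
    [s]; the last conclusion, the degree of the centre, is what lets the
    induction on [j] compute the effect of the next edge. *)
Lemma add_star G s j : supported G s -> s + j < n ->
  exists H, [/\ supported H (s + j).+1,
    num_frustrated H + j * j.-1 = num_frustrated G + j * (n - 2)
  & forall c : 'I_n, c = s :> nat -> #|[set y | H c y]| = j].
Proof.
move=> supG; elim: j => [|j IHj] lt_sjn.
  exists G; split=> [x y /supG||c cs]; rewrite ?mul0n ?addn0 //; first by lia.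
  by apply/eqP; rewrite cards_eq0; apply/eqP/setP => y; rewrite !inE;
     apply/negP => /supG; rewrite cs ltnn.
have [|H [supH eqH cardH]] := IHj; first by lia.
have lt_sn : s < n by lia.
pose c := Ordinal lt_sn; pose l := Ordinal lt_sjn.
have Hl y : H l y = false by apply/negP => /supH /=; lia.
have cl : c != l by rewrite -val_eqE /=; lia.
have Hcl : ~~ H c l by rewrite adj_sym Hl.
have addH := add_edgeP cl Hcl.
exists (add_edge H c l); split=> [x y||c' c's].
- rewrite /= /add_rel /= => /andP[_ /orP[/supH|]]; first by lia.
  by case/orP => /andP[/eqP-> _] /=; lia.
- have := num_frustrated_add addH; rewrite card_ord.
  have -> : split_nbrs H c l = [set y | H c y].
    apply/setP => w; rewrite !inE Hl addbF.
    case: (eqVneq w c) => [->|_]; first by rewrite adj_irr.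
    by case: (eqVneq w l) => [->|_] //; rewrite (negPf Hcl).
  move: eqH; rewrite (cardH c) // -pred_Sn; move: (n - 2) => p.
  move: (num_frustrated _) (num_frustrated _) (num_frustrated _) => f1 f2 f3.
  by clear; case: j => [|i]; rewrite -?pred_Sn; nia.
- have -> : c' = c by apply: val_inj.
  have -> : [set y | add_edge H c l c y] = l |: [set y | H c y].
    apply/setP => y; rewrite !inE /= /add_rel /= /same_pair eqxx (negPf cl) /= orbF.
    case: (eqVneq y l) => [->|_]; first by rewrite cl orbT.
    by case: eqVneq => [<-|_]; rewrite ?adj_irr ?orbF.
  by rewrite cardsU1 !inE Hcl (cardH c).
Qed.

(** Some graph supported below [s] has [b + t * (n - 2) - P] frustrated triangles.
    This is the value obtained from a graph with [b] of them by adding disjoint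
    stars with [t] edges in all, [P] being the sum of [j * (j - 1)] over the
    stars with [j] edges. *)
Definition attained b s t P :=
  exists G, supported G s /\ num_frustrated G + P = b + t * (n - 2).

Lemma attained_star b s t P j : attained b s t P -> s + j < n ->
  attained b (s + j.+1) (t + j) (P + j * j.-1).
Proof.
case=> G [supG eqG] lt_sjn; have [H [supH eqH _]] := add_star supG lt_sjn.
by exists H; split; [rewrite addnS | rewrite mulnDl; lia].
Qed.

Lemma attained_stars b s t P j r : attained b s t P -> s + r * j.+1 <= n ->
  attained b (s + r * j.+1) (t + r * j) (P + r * (j * j.-1)).
Proof.
move=> att; elim: r => [|r IHr] le_n; first by rewrite !mul0n !addn0.
rewrite !mulSnr !addnA; apply: attained_star; last by lia.
by apply: IHr; lia.
Qed.

(** Stars with [k] and [k'] edges, [r] stars with two edges and single edges that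
    bring the total number of edges to [t]. *)
Lemma attained_forest b s t k k' r :
  attained b s 0 0 -> k + k' + 2 * r <= t -> s + 2 * t + 2 <= n ->
  exists G, num_frustrated G + (k * k.-1 + k' * k'.-1 + 2 * r) = b + t * (n - 2).
Proof.
move=> att le_t le_n.
have att1 : attained b (s + k.+1) (0 + k) (0 + k * k.-1) by apply: attained_star => //; lia.
have {}att1 := @attained_star _ _ _ _ k' att1 _.
have {att1}att2 := @attained_stars _ _ _ _ 2 r (att1 _) _.
have {att2}[|||G [_ eqG]] := @attained_stars _ _ _ _ 1 (t - (k + k' + 2 * r)) (att2 _ _) _.
all: try by lia.
by exists G; move: eqG; move: (n - 2) => p; rewrite !muln1 /=; nia.
Qed.

End Forests.

Lemma pronic_floor x : exists k, k * k.-1 <= x < k.+1 * k.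
Proof.
elim: x => [|x [k /andP[le_x lt_x]]]; first by exists 1.
have [le|lt] := ltnP x.+1 (k.+1 * k); first by exists k; lia.
by exists k.+1; rewrite -pred_Sn; lia.
Qed.

(** The greedy decomposition; [k + k' + 2 * r] is then [sqrt x + O(x^(1/4))]. *)
Lemma three_pronics x : ~~ odd x -> exists k k' r,
  [/\ x = k * k.-1 + k' * k'.-1 + 2 * r, k * k.-1 <= x,
      k' * k'.-1 <= 2 * k & r <= k'].
Proof.
move=> even_x; have [k /andP[le_k lt_k]] := pronic_floor x.
have [k' /andP[le_k' lt_k']] := pronic_floor (x - k * k.-1).
have even2 m : ~~ odd (m * m.-1) by case: m => // m; rewrite oddM /= andNb.
have lt2 m y : y < m.+1 * m -> y < m * m.-1 + 2 * m by case: m => //= m; lia.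
have /lt2 {}lt_k := lt_k; have /lt2 {}lt_k' := lt_k'.
pose y := x - k * k.-1 - k' * k'.-1.
have even_y : ~~ odd y by rewrite !oddB // (negPf even_x) (negPf (even2 k)) (negPf (even2 k')).
exists k, k', y./2; have := odd_double_half y; rewrite (negPf even_y) add0n -mul2n /y => def_y.
by split=> //; lia.
Qed.

(** * Attained values *)

Lemma F_compl n m : m <= 'C(n, 3) -> F n ('C(n, 3) - m) -> F n m.
Proof.
move=> le_m [G fG]; exists (compl G).
by have := num_frustrated_compl G; rewrite card_ord; lia.
Qed.

(** As [num_frustrated G] is even for every [G] on [n] vertices, so is its sum
    with the value of the complement. *)
Lemma even_bin3 n : ~~ odd n -> ~~ odd 'C(n, 3).
Proof.
move=> even_n; pose G := clique (set0 : {set 'I_n}).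
have := num_frustrated_compl G; rewrite card_ord => <-.
by rewrite oddD !odd_num_frustrated card_ord (negPf even_n) !andbF.
Qed.

(** The least number [t] of edges with [r <= t * (n - 2)], or the next one when
    [d = 2] and the loss [S] would be odd. *)
Lemma choose_edges n d r T : 2 < n -> (d = 1 /\ ~~ odd n /\ ~~ odd r) \/ (d = 2 /\ odd n) ->
  T * (n - 2) <= r <= T * (n - 2) + n ->
  exists t S, [/\ r + S = t * (n - 2), ~~ odd S, S < d * n & T <= t <= T + 5].
Proof.
move=> n2 dP /andP[le_r ge_r]; have [p def_n] : exists p, n = p.+3 by exists (n - 3); lia.
have odd_p : odd p.+1 = odd n by rewrite def_n /= negbK.
have defp : n - 2 = p.+1 by lia.
rewrite defp in le_r ge_r *.
pose t0 := (r + p) %/ p.+1.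
have := divn_eq (r + p) p.+1; have := ltn_pmod (r + p) (ltn0Sn p); rewrite -/t0.
set q := _ %% _ => lt_q eq_q.
have le_Tt : T <= t0 by rewrite leq_divRL //; lia.
have lt_tT : t0 <= T + 3 by rewrite -ltnS ltn_divLR //; lia.
have S0 : r + (t0 * p.+1 - r) = t0 * p.+1 by lia.
case: dP => [[-> [even_n even_r]]|[-> odd_n]].
  exists t0, (t0 * p.+1 - r); split=> //; [|lia|lia].
  by rewrite oddB ?oddM ?odd_p ?(negPf even_n) ?andbF ?(negPf even_r) //; lia.
have [odd_S|even_S] := boolP (odd (t0 * p.+1 - r)); last first.
  by exists t0, (t0 * p.+1 - r); split=> //; lia.
exists t0.+1, (t0 * p.+1 - r + p.+1); split; [lia| |lia|lia].
by rewrite oddD odd_S odd_p odd_n.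
Qed.

(** Every [m], even if [n] is even, between [T * (n - 2)] and half the number of
    triples is attained, where [T = a + 3 * c] bounds the number of edges of the
    forests realising the losses below [d * n], with [a] about [sqrt (d * n)]
    and [c] about [sqrt (2 * a)]. *)
Lemma mem_F n d a c m :
  (d = 1 /\ ~~ odd n /\ ~~ odd m) \/ (d = 2 /\ odd n) ->
  d * n <= a ^ 2 -> 2 * a + 2 <= c ^ 2 ->
  6 * (a + 3 * c) + 60 <= n ->
  (a + 3 * c) * (n - 2) <= m -> 2 * m <= 'C(n, 3) -> F n m.
Proof.
move=> dP le_a le_c le_n le_m le_m2; pose b := n %/ 3.
have [T defT] : exists T, T = a + 3 * c by exists (a + 3 * c).
rewrite -defT in le_n le_m.
(* The clique uses the first n - b vertices, the forest the last b = n %/ 3. *)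
pose A := [set x : 'I_n | x < n - b].
have cardA : #|~: A| = b.
  have le_nb : n - b <= n by lia.
  have -> : ~: A = ~: [set widen_ord le_nb x | x in 'I_(n - b)].
    congr (~: _); apply/setP => x; rewrite inE; apply/idP/imsetP => [lt_x|[y _ ->]] //.
      by exists (Ordinal lt_x) => //; apply: val_inj.
    exact: (ltn_ord y).
  rewrite cardsCs setCK card_imset ?card_ord; last first.
    by move=> x y /(congr1 val) xy; apply: val_inj.
  by rewrite subKn // leq_div.
have le_C : 'C(n, 3) <= 2 * num_frustrated (clique A).
  by apply: clique_half_bin3; rewrite cardA mulnC leq_trunc_div.
have [|G [sGA le_fG ge_fG]] := @num_frustrated_near _ (clique A) (m - T * (n - 2)).
  by apply: leq_trans (leq_subr _ _) _; rewrite -(@leq_pmul2l 2) // (leq_trans le_m2).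
rewrite card_ord in ge_fG; have le_fm := leq_trans le_fG (leq_subr _ _).
have att : attained n (num_frustrated G) (n - b) 0 0.
  exists G; split=> [x y /sGA|]; last by rewrite mul0n.
  by rewrite /= /clique_rel /= inE => /and3P[].
have odd_fG : odd (num_frustrated G) = odd #|edges G| && odd n.
  by rewrite odd_num_frustrated card_ord.
have [||| t [S [eqS even_S lt_S /andP[le_Tt le_tT]]]] :=
  @choose_edges n d (m - num_frustrated G) T.
- by lia.
- case: dP => [[-> [even_n even_m]]|]; [left|by right].
  split=> //; split=> //; rewrite oddB //.
  by rewrite odd_fG (negPf even_n) (negPf even_m) andbF.
- by lia.
have [k [k' [r [defS le_k le_k' le_r]]]] := three_pronics even_S.
have le_ka : k <= a.
  have {}le_k := leq_ltn_trans le_k lt_S.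
  rewrite leqNgt; apply/negP => lt_ak; move: le_k le_a; move: (d * n) => dn.
  by case: (k) lt_ak => // k0; rewrite ltnS -mulnn -pred_Sn => lt; have := leq_mul lt lt; lia.
have le_kc : k' <= c.
  rewrite leqNgt; apply/negP => lt_ck; move: le_k' le_c.
  by case: (k') lt_ck => // k0; rewrite ltnS -mulnn -pred_Sn => lt; have := leq_mul lt lt; lia.
have le_t : k + k' + 2 * r <= t.
  by apply: leq_trans le_Tt; rewrite defT; clear - le_ka le_kc le_r; lia.
have le_nbt : n - b + 2 * t + 2 <= n by rewrite /b; clear - le_n le_tT; lia.
have [G' eqG'] := attained_forest att le_t le_nbt.
by exists G'; clear - eqG' eqS defS le_fm; lia.
Qed.

(** * Asymptotic form of the bounds *)

(** The gap of [gap_notin_F] with [t = u - d]: its first candidate has the right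
    parity and lies in the lower half of the range. *)
Lemma gap_below_half n d u :
  (d == 1) || (d == 2) && odd n -> 9 < u -> 4 * u < n -> u ^ 2 <= d * n ->
  exists t, let m := t * (n - 2) + 2 in
    [/\ u = t + d, odd n || ~~ odd m, ~ F n m & 2 * m <= 'C(n, 3)].
Proof.
move=> dP u9 lt_un le_u.
have d2 : d <= 2 by case/orP: dP => [|/andP[]]/eqP->.
have le_du : d <= u by lia.
have def_u : u = u - d + d by rewrite subnK.
exists (u - d); split=> //.
- case on: (odd n) => //=; rewrite oddD oddM oddB ?on ?andbF //; lia.
- by apply: gap_notin_F dP _ _ _; rewrite -?def_u //; lia.
have := bin3_ffact n; have [p def_n] : exists p, n = p.+3 by exists (n - 3); lia.
have : (u - d) * p.+1 <= u * p.+1 by rewrite leq_mul2r leq_subr orbT.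
have : 4 * u * p.+1 <= n * p.+1 by rewrite leq_mul2r ltnW ?orbT.
have -> : n - 2 = p.+1 by lia.
have p30 : 30 <= p by lia.
have := leq_mul (leqnn (p.+3 * p.+1)) p30.
by rewrite def_n /=; lia.
Qed.

Import Order.TTheory GRing.Theory Num.Theory.
Local Open Scope ring_scope.

Section Asymptotics.
Variable R : realType.
Implicit Types (n d m : nat) (r s : R).

Lemma powR_quarter (x : R) (k : nat) : 0 <= x -> x `^ (k%:R / 4) = (x `^ (1 / 4)) ^+ k.
Proof.
move=> x0; rewrite -powR_mulrn ?powR_ge0 // -powRrM; congr (_ `^ _).
by rewrite mul1r mulrC.
Qed.

Lemma nat_near (x : R) : 0 <= x -> exists k : nat, k%:R <= x < k%:R + 1.
Proof.
by move=> x0; exists (Num.truncn x); rewrite natr1; apply: truncn_itv.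
Qed.

(** Here [r] is [n^(1/4)], so that [r ^+ 6 = n^(3/2)] and [r ^+ 5 = n^(5/4)], and
    [s] is [sqrt d].  The parameters of [mem_F] are the integers just above
    [s * r ^+ 2] and [3 * r], which bounds [T] by [s * r ^+ 2 + 9 * r + 4]; this
    is where [13] comes from. *)
Lemma mem_F_asymp n d m r s :
  (d = 1 /\ ~~ odd n /\ ~~ odd m \/ d = 2 /\ odd n)%N ->
  n%:R = r ^+ 4 -> 10 <= r -> s ^+ 2 = d%:R -> 1 <= s <= 3 / 2 ->
  s * r ^+ 6 + 13 * r ^+ 5 <= m%:R -> (2 * m <= 'C(n, 3))%N -> F n m.
Proof.
move=> dP def_n r10 def_d /andP[s1 s2] le_m; have r0 : 0 <= r by lra.
have sr0 : 0 <= s * r ^+ 2 by rewrite mulr_ge0 ?exprn_ge0 //; lra.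
have [a0 /andP[a0_le a0_gt]] := nat_near sr0.
have [|c0 /andP[c0_le c0_gt]] := @nat_near (3 * r); first by lra.
have r2 : r ^+ 2 >= 10 * r by rewrite expr2 ler_wpM2r.
have def_n2 : n%:R = r ^+ 2 * r ^+ 2 :> R by rewrite def_n -exprD.
have le_T : (a0.+1 + 3 * c0.+1)%:R <= s * r ^+ 2 + 9 * r + 4 :> R.
  by rewrite natrD natrM -!natr1; lra.
apply: (@mem_F n d a0.+1 c0.+1) dP _ _ _ _.
- rewrite -(ler_nat R) natrM natrX -natr1 -def_d def_n2.
  have -> : s ^+ 2 * (r ^+ 2 * r ^+ 2) = (s * r ^+ 2) ^+ 2 by ring.
  by rewrite lerXn2r ?nnegrE //; lra.
- rewrite -(ler_nat R) natrX natrD natrM -!natr1.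
  have : (3 * r) ^+ 2 <= (c0%:R + 1) ^+ 2 by rewrite lerXn2r ?nnegrE //; lra.
  have : s * r ^+ 2 <= 3 / 2 * r ^+ 2 by rewrite ler_wpM2r // exprn_ge0.
  by rewrite exprMn; lra.
- rewrite -(ler_nat R) natrD natrM def_n2.
  have : s * r ^+ 2 <= 3 / 2 * r ^+ 2 by rewrite ler_wpM2r // exprn_ge0.
  have : 100 * r ^+ 2 <= r ^+ 2 * r ^+ 2 by rewrite ler_wpM2r ?exprn_ge0 //; lra.
  by lra.
- rewrite -(ler_nat R); apply: le_trans le_m; rewrite natrM.
  have le_n : (n - 2)%:R <= n%:R :> R by rewrite ler_nat leq_subr.
  apply: le_trans (_ : (s * r ^+ 2 + 9 * r + 4) * r ^+ 4 <= _).
    by rewrite ler_pM // -def_n.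
  have : r ^+ 4 <= r * r ^+ 4 by rewrite ler_peMl ?exprn_ge0 //; lra.
  have -> : (s * r ^+ 2 + 9 * r + 4) * r ^+ 4 = s * r ^+ 6 + 9 * r ^+ 5 + 4 * r ^+ 4 by ring.
  by rewrite -exprS; lra.
Qed.

(** The upper half of the range is reached by complements. *)
Lemma mem_F_middle n d m r s :
  (d = 1 /\ ~~ odd n /\ ~~ odd m \/ d = 2 /\ odd n)%N ->
  n%:R = r ^+ 4 -> 10 <= r -> s ^+ 2 = d%:R -> 1 <= s <= 3 / 2 ->
  s * r ^+ 6 + 13 * r ^+ 5 <= m%:R ->
  m%:R <= 'C(n, 3)%:R - (s * r ^+ 6 + 13 * r ^+ 5) -> F n m.
Proof.
move=> dP def_n r10 def_d s12 le_m ge_m.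
have [|lt_m2] := leqP (2 * m) 'C(n, 3); first exact: (mem_F_asymp dP def_n r10 def_d s12 le_m).
have le_mC : (m <= 'C(n, 3))%N.
  rewrite -(ler_nat R); apply: le_trans ge_m _; rewrite gerBl.
  have [s1 s2] := andP s12; have r0 : 0 <= r by lra.
  by rewrite addr_ge0 ?mulr_ge0 ?exprn_ge0 //; lra.
apply: F_compl => //; apply: mem_F_asymp def_n r10 def_d s12 _ _.
- case: dP => [[d1 [even_n even_m]]|]; [left|by right].
  by rewrite oddB // (negPf (even_bin3 even_n)).
- by rewrite natrB //; lra.
- by lia.
Qed.

(** The gap with [u] the integer part of [sqrt (d * n)], that is, of
    [s * r ^+ 2]. *)
Lemma notin_F_asymp n d r s :
  ((d == 1) || (d == 2) && odd n)%N ->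
  n%:R = r ^+ 4 -> 10 <= r -> s ^+ 2 = d%:R -> 1 <= s <= 3 / 2 ->
  exists m : nat, [/\ odd n || ~~ odd m, ~ F n m, m%:R <= 2^-1 * 'C(n, 3)%:R :> R
    & `|m%:R - s * r ^+ 6| <= 13 * r ^+ 5].
Proof.
move=> dP def_n r10 def_d /andP[s1 s2]; have r0 : 0 <= r by lra.
have sr0 : 0 <= s * r ^+ 2 by rewrite mulr_ge0 ?exprn_ge0 //; lra.
have [u /andP[u_le u_gt]] := nat_near sr0.
have r2 : r ^+ 2 >= 10 * r by rewrite expr2 ler_wpM2r.
have sr2 : s * r ^+ 2 <= 3 / 2 * r ^+ 2 by rewrite ler_wpM2r // exprn_ge0.
have sr1 : r ^+ 2 <= s * r ^+ 2 by rewrite ler_peMl // exprn_ge0.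
have r4 : 100 * r ^+ 2 <= r ^+ 4.
  by rewrite -[4%N]/(2 + 2)%N exprD ler_wpM2r ?exprn_ge0 //; lra.
have r5 : r ^+ 4 <= r ^+ 5 by rewrite exprS ler_peMl ?exprn_ge0 //; lra.
have d12 : (0 < d <= 2)%N by case/orP: dP => [|/andP[]]/eqP->.
have u9 : (9 < u)%N by rewrite -ltnS -(ltr_nat R) -natr1; lra.
have lt_un : (4 * u < n)%N by rewrite -(ltr_nat R) natrM def_n; lra.
have le_dn : (u ^ 2 <= d * n)%N.
  rewrite -(ler_nat R) natrM natrX -def_d def_n.
  have -> : s ^+ 2 * r ^+ 4 = (s * r ^+ 2) ^+ 2 by ring.
  by rewrite lerXn2r ?nnegrE //; lra.
have [t [def_u even_m m_notin le_m2]] := gap_below_half dP u9 lt_un le_dn.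
exists (t * (n - 2) + 2)%N; split=> //.
  by rewrite mulrC ler_pdivlMr ?ltr0n // -natrM ler_nat mulnC.
have d1 : 1 <= (d%:R : R) <= 2 by rewrite ler1n (ler_nat R d 2).
have n2 : (2 <= n)%N by clear - u9 lt_un; lia.
have def_t : t%:R = u%:R - d%:R :> R by rewrite def_u natrD addrK.
have def_m : (t * (n - 2) + 2)%:R - s * r ^+ 6
    = (u%:R - d%:R - s * r ^+ 2) * r ^+ 4 - 2 * (u%:R - d%:R) + 2 :> R.
  by rewrite natrD natrM natrB // def_n def_t; ring.
have r40 : 0 <= r ^+ 4 by rewrite exprn_ge0.
have ub : (u%:R - d%:R - s * r ^+ 2) * r ^+ 4 <= - 1 * r ^+ 4 by rewrite ler_wpM2r //; lra.
have lb : - 3 * r ^+ 4 <= (u%:R - d%:R - s * r ^+ 2) * r ^+ 4 by rewrite ler_wpM2r //; lra.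
have u0 := ler0n R u; rewrite def_m ler_norml.
set q := (_ * r ^+ 4) in ub lb *; clear - ub lb r4 r5 d1 u0 sr2 r40 u_le r2 r10.
by apply/andP; split; lra.
Qed.

End Asymptotics.

Theorem theorem2 (R : realType) :
  exists (C : R) (N : nat), 0 < C /\
    forall n : nat, (N <= n)%N ->
      (~~ odd n ->
        (forall m : nat, ~~ odd m ->
           n%:R `^ (3 / 2) + C * n%:R `^ (5 / 4) <= m%:R ->
           m%:R <= 'C(n, 3)%:R - (n%:R `^ (3 / 2) + C * n%:R `^ (5 / 4)) ->
           F n m)
        /\
        (exists m : nat,
           [/\ ~~ odd m, ~ F n m, m%:R <= 2^-1 * 'C(n, 3)%:R :> R
             & `|m%:R - n%:R `^ (3 / 2)| <= C * n%:R `^ (5 / 4)]))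
      /\
      (odd n ->
        (forall m : nat,
           Num.sqrt 2 * n%:R `^ (3 / 2) + C * n%:R `^ (5 / 4) <= m%:R ->
           m%:R <= 'C(n, 3)%:R
             - (Num.sqrt 2 * n%:R `^ (3 / 2) + C * n%:R `^ (5 / 4)) ->
           F n m)
        /\
        (exists m : nat,
           [/\ ~ F n m, m%:R <= 2^-1 * 'C(n, 3)%:R :> R
             & `|m%:R - Num.sqrt 2 * n%:R `^ (3 / 2)|
                 <= C * n%:R `^ (5 / 4)])).
Proof.
exists 13, (10 ^ 4)%N; split=> [|n le_n]; first by rewrite ltr0n.
pose r : R := n%:R `^ (1 / 4).
have r0 : 0 <= r by apply: powR_ge0.
have def_n : n%:R = r ^+ 4.
  by rewrite -powR_quarter ?ler0n // divff ?pnatr_eq0 // powRr1 ?ler0n.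
have -> : n%:R `^ (5 / 4) = r ^+ 5 :> R by apply: powR_quarter; apply: ler0n.
have -> : n%:R `^ (3 / 2) = r ^+ 6 :> R.
  by rewrite -powR_quarter ?ler0n //; congr (_ `^ _); field.
have r10 : 10 <= r.
  rewrite -(@ler_pXn2r _ 4) ?nnegrE // -def_n -natrX ler_nat.
  exact: le_n.
clearbody r; clear le_n.
have sqrt2 : Num.sqrt 2 ^+ 2 = 2%:R :> R by rewrite sqr_sqrtr.
have sqrt2_itv : 1 <= (Num.sqrt 2 : R) <= 3 / 2.
  have sqrt0 := sqrtr_ge0 (2 : R); apply/andP; split; nra.
have one2 : (1 : R) ^+ 2 = 1%:R by rewrite expr1n.
have one_itv : 1 <= (1 : R) <= 3 / 2 by apply/andP; split; lra.
rewrite -[in X in X /\ _](mul1r (r ^+ 6)).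
split=> par_n; split.
- move=> m par_m; apply: (mem_F_middle _ def_n r10 one2 one_itv).
  by left.
- have [|m [+ notF le_m near_m]] := @notin_F_asymp R n 1 r 1 _ def_n r10 one2 one_itv; first by [].
  by rewrite (negPf par_n) => even_m; exists m.
- by move=> m; apply: (mem_F_middle _ def_n r10 sqrt2 sqrt2_itv); right.
- have [|m [_ notF le_m near_m]] := @notin_F_asymp R n 2 r (Num.sqrt 2) _ def_n r10 sqrt2 sqrt2_itv.
    by rewrite par_n.
  by exists m.
Qed.
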